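(* Let $\hat x_0\in\mathbb R^d$ be any given solution (not necessarily feasible), let $k=(k_j)_{j=1,\ldots,l}\in\mathbb R^l$ be a vector with positive entries, and let $\rho$ be the $(1-\epsilon)$-quantile of $$\max_{j=1,\ldots,l}\frac{g_j(\hat x_0;\xi)-b_j}{k_j}$$ under $\xi\sim P$. Then any feasible solution of the reconstructed robust optimization problem $$\text{minimize } f(x)\ \text{ subject to }\ g(x;\xi)\le b\ \ \forall\,\xi:\ g(\hat x_0;\xi)\le b+\rho k$$ is also feasible for the chance-constrained program $$\text{minimize } f(x)\ \text{ subject to }\ P(g(x;\xi)\le b)\ge 1-\epsilon .$$
   Context: $\epsilon\in(0,1)$; $x\in\mathbb R^d$ is the decision vector, $f$ a real-valued objective, $\xi\in\mathbb R^m$ a random vector with distribution $P$, $g(x;\xi)=(g_j(x;\xi))_{j=1,\ldots,l}\in\mathbb R^l$, and $b=(b_j)_{j=1,\ldots,l}\in\mathbb R^l$. Vector inequalities are componentwise. The $(1-\epsilon)$-quantile of a real random variable $Y$ is $\inf\{y: P(Y\le y)\ge 1-\epsilon\}$. *)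

(* Defs.v *)
From HB Require Import structures.
From mathcomp Require Import all_boot all_order all_algebra.
From mathcomp Require Import all_classical all_reals all_analysis.
Set Implicit Arguments.
Unset Strict Implicit.
Unset Printing Implicit Defensive.
Import Order.TTheory GRing.Theory Num.Theory.
Import numFieldNormedType.Exports.
Local Open Scope classical_set_scope.
Local Open Scope ring_scope.

(* R^n with its Borel sigma-algebra; the carrier is 'rV[R]_n itself. *)
Definition borel_vec (R : realType) (n : nat) :=
  g_sigma_algebraType (@open 'rV[R]_n).

Definition vec_le (R : realType) (n : nat) (u v : 'rV[R]_n) : Prop :=
  forall j : 'I_n, u ord0 j <= v ord0 j.

(* The index set is nonempty, so seeding the fold with the first entry yields
   the genuine maximum. *)
Definition vec_max (R : realType) (n : nat) (u : 'rV[R]_n.+1) : R :=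
  \big[Num.max/u ord0 ord0]_(j < n.+1) u ord0 j.

(* Meaningful for measurable Y and 0 < p < 1, in which case the set below is
   nonempty and bounded from below. *)
Definition quantile (d : measure_display) (T : measurableType d)
    (R : realType) (P : probability T R) (Y : T -> R) (p : R) : R :=
  inf [set y : R | (p%:E <= P [set w | (Y w <= y)%R])%E].

Record program (R : realType) (d : nat) := Program {
  objective : 'rV[R]_d -> R;  (* to be minimized *)
  feasible : set 'rV[R]_d
}.

Definition chance_constrained (R : realType) (d m l : nat)
    (f : 'rV[R]_d -> R) (g : 'rV[R]_d -> 'rV[R]_m -> 'rV[R]_l) (b : 'rV[R]_l)
    (P : probability (borel_vec R m) R) (eps : R) : program R d :=
  Program f [set x | ((1 - eps)%R%:E <= P [set xi | vec_le (g x xi) b])%E].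

Definition robust (R : realType) (d m l : nat)
    (f : 'rV[R]_d -> R) (g : 'rV[R]_d -> 'rV[R]_m -> 'rV[R]_l) (b : 'rV[R]_l)
    (U : set 'rV[R]_m) : program R d :=
  Program f [set x | forall xi, U xi -> vec_le (g x xi) b].

Definition reconstructed_set (R : realType) (d m l : nat)
    (g : 'rV[R]_d -> 'rV[R]_m -> 'rV[R]_l) (b : 'rV[R]_l)
    (x0 : 'rV[R]_d) (k : 'rV[R]_l) (rho : R) : set 'rV[R]_m :=
  [set xi | vec_le (g x0 xi) (b + rho *: k)].

Definition max_scaled_excess (R : realType) (d m l : nat)
    (g : 'rV[R]_d -> 'rV[R]_m -> 'rV[R]_l.+1) (b : 'rV[R]_l.+1)
    (x0 : 'rV[R]_d) (k : 'rV[R]_l.+1) (xi : 'rV[R]_m) : R :=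
  vec_max (\row_j ((g x0 xi ord0 j - b ord0 j) / k ord0 j)).

(* Main.v *)
Require Import Defs.
From HB Require Import structures.
From mathcomp Require Import all_boot all_order all_algebra.
From mathcomp Require Import all_classical all_reals all_analysis.
From mathcomp Require Import measurable_realfun.
Set Implicit Arguments.
Unset Strict Implicit.
Unset Printing Implicit Defensive.
Import Order.TTheory GRing.Theory Num.Theory.
Import numFieldNormedType.Exports.
Local Open Scope classical_set_scope.
Local Open Scope ring_scope.

(** A point [xi] lies in the reconstructed uncertainty set exactly when the
    maximal scaled excess of [g x0 xi] over [b] is at most [rho], because
    dividing by the positive entries of [k] turns the vector inequality
    [g x0 xi <= b + rho *: k] into a bound on every scaled excess
    ([reconstructed_setE]).  As [rho] is the [(1 - eps)]-quantile of that
    maximum, the uncertainty set has probability at least [1 - eps]; here the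
    infimum defining the quantile has to be attained, which is where right
    continuity of distribution functions enters ([quantile_attained]).  A
    robust feasible [x] satisfies the constraints on the whole uncertainty set,
    so the event [g x xi <= b] contains it, and monotonicity of [P] gives the
    chance constraint. *)

Lemma vec_max_leP (R : realType) (n : nat) (u : 'rV[R]_n.+1) (y : R) :
  vec_max u <= y <-> forall j, u ord0 j <= y.
Proof.
split=> [uy j|uy]; first by apply: le_trans uy; exact: le_bigmax.
by apply: bigmax_le.
Qed.

Lemma measurable_bigmax (d : measure_display) (T : measurableType d)
    (R : realType) (I : Type) (s : seq I) (h0 : T -> R) (h : I -> T -> R) :
  measurable_fun [set: T] h0 -> (forall i, measurable_fun [set: T] (h i)) ->
  measurable_fun [set: T] (fun t => \big[Num.max/h0 t]_(i <- s) h i t).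
Proof.
move=> mh0 mh; elim: s => [|i s IHs].
  by under eq_fun do rewrite big_nil.
under eq_fun do rewrite big_cons.
exact: measurable_maxr.
Qed.

(** Let [F] be the distribution function of [Y].  The bounds [0 < p < 1] make
    the set where [p <= F] bounded below ([F] tends to 0 at [-oo]) and nonempty
    ([F] tends to 1 at [+oo]), so its infimum [q] is genuine.  Every point to
    the right of [q] is in this set since [F] is nondecreasing, and right
    continuity carries [p <= F] over to [q] itself. *)
Lemma quantile_attained (d : measure_display) (T : measurableType d)
    (R : realType) (P : probability T R) (Y : T -> R) (p : R) :
  measurable_fun [set: T] Y -> 0 < p < 1 ->
  (p%:E <= P [set w | (Y w <= quantile P Y p)%R])%E.
Proof.
move=> mY /andP[p_gt0 p_lt1].
pose X : {RV P >-> R} := mfun_Sub (mem_set mY : Y \in mfun).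
have cdfE y : cdf X y = P [set w | Y w <= y] by [].
rewrite /quantile; set S := (A in inf A).
have SE y : S y <-> (p%:E <= cdf X y)%E by rewrite cdfE.
have S_neq0 : S !=set0.
  have [M [_ FM]] := cvg_cdfy1 X (@open_ereal_gt' _ 1%E p%:E p_lt1).
  by exists (M + 1); apply/SE/ltW/FM; rewrite ltrDl.
have S_lb : has_lbound S.
  have [M [_ FM]] := cvg_cdfNy0 X (@open_ereal_lt' _ 0%E p%:E p_gt0).
  by exists M => y /SE; rewrite !leNgt; apply: contra => /FM.
rewrite -cdfE; apply: cvge_ge (@cdf_right_continuous _ _ _ P X (inf S)).
near=> y.
have /(inf_lt S_neq0)[z Sz zy] : inf S < y by near: y; exact: nbhs_right_gt.
move/SE: Sz => /le_trans; apply; apply: cdf_nondecreasing; exact: ltW.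
Unshelve. all: end_near.
Qed.

Lemma reconstructed_setE (R : realType) (d m l : nat)
    (g : 'rV[R]_d -> 'rV[R]_m -> 'rV[R]_l.+1) (b : 'rV[R]_l.+1)
    (x0 : 'rV[R]_d) (k : 'rV[R]_l.+1) (rho : R) :
  (forall j, 0 < k ord0 j) ->
  reconstructed_set g b x0 k rho =
  [set xi | max_scaled_excess g b x0 k xi <= rho].
Proof.
move=> k_gt0; apply/seteqP; split=> xi /=.
  move=> gxi; apply/vec_max_leP => j; have := gxi j.
  by rewrite !mxE ler_pdivrMr// lerBlDl.
move=> /vec_max_leP exc j; have := exc j.
by rewrite !mxE ler_pdivrMr// lerBlDl.
Qed.

Lemma measurable_max_scaled_excess (R : realType) (d m l : nat)
    (g : 'rV[R]_d -> 'rV[R]_m -> 'rV[R]_l.+1) (b : 'rV[R]_l.+1)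
    (x0 : 'rV[R]_d) (k : 'rV[R]_l.+1) :
  (forall j, measurable_fun [set: borel_vec R m]
     (fun xi : borel_vec R m => g x0 xi ord0 j)) ->
  measurable_fun [set: borel_vec R m] (max_scaled_excess g b x0 k).
Proof.
move=> mg.
apply: (@measurable_bigmax _ (borel_vec R m) R _ _
  (fun xi => (\row_j ((g x0 xi ord0 j - b ord0 j) / k ord0 j)) ord0 ord0)
  (fun j xi => (\row_j ((g x0 xi ord0 j - b ord0 j) / k ord0 j)) ord0 j)) => [|j];
  under eq_fun do rewrite mxE;
  by apply: measurable_funM => //; exact: measurable_funB.
Qed.

Lemma measurable_vec_le (d : measure_display) (T : measurableType d)
    (R : realType) (n : nat) (G : T -> 'rV[R]_n) (b : 'rV[R]_n) :
  (forall j, measurable_fun [set: T] (fun t => G t ord0 j)) ->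
  measurable [set t | vec_le (G t) b].
Proof.
move=> mG.
rewrite (_ : [set t | _] =
    \bigcap_(j in [set: 'I_n]) [set t | G t ord0 j <= b ord0 j]).
  apply: fin_bigcap_measurable => // j _.
  rewrite -[X in measurable X]setTI.
  have := mG j measurableT _ (measurable_itv `]-oo, b ord0 j]).
  by congr measurable; apply/seteqP; split=> t /=; rewrite in_itv.
by apply/seteqP; split=> [t tb j _|t tb j]; [exact: tb|exact: tb j I].
Qed.

Theorem theorem3 (R : realType) (d m l : nat)
    (eps : R) (eps01 : 0 < eps < 1)
    (f : 'rV[R]_d -> R)
    (g : 'rV[R]_d -> 'rV[R]_m -> 'rV[R]_l.+1) (b : 'rV[R]_l.+1)
    (P : probability (borel_vec R m) R)
    (mg : forall (x : 'rV[R]_d) (j : 'I_l.+1),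
       measurable_fun [set: borel_vec R m]
         (fun xi : borel_vec R m => g x xi ord0 j))
    (x0 : 'rV[R]_d) (k : 'rV[R]_l.+1) (k_gt0 : forall j, 0 < k ord0 j)
    (rho : R)
    (rhoE : rho = quantile P (max_scaled_excess g b x0 k) (1 - eps))
    (x : 'rV[R]_d) :
  feasible (robust f g b (reconstructed_set g b x0 k rho)) x ->
  feasible (chance_constrained f g b P eps) x.
Proof.
move=> /= robust_x.
have mU : measurable (reconstructed_set g b x0 k rho : set (borel_vec R m)).
  exact: (@measurable_vec_le _ (borel_vec R m)).
have PU : ((1 - eps)%:E <= P (reconstructed_set g b x0 k rho))%E.
  rewrite reconstructed_setE// rhoE; apply: quantile_attained.
    exact: measurable_max_scaled_excess.
  by case/andP: eps01 => eps_gt0 eps_lt1; rewrite subr_gt0 eps_lt1 gtrBl.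
apply: (le_trans PU); apply: le_measure; rewrite ?inE//.
exact: (@measurable_vec_le _ (borel_vec R m)).
Qed.
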